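(* Let $G$ be a simple connected graph and let $m>3$ be an even integer. Then $G$ has property (-SR) if and only if $F_1^m(G)$ has property (SR).
   Context: A graph is nonsingular if its adjacency matrix is nonsingular. A nonsingular graph $G$ has property (SR) if for each eigenvalue $\lambda$ of $A(G)$, $1/\lambda$ is also an eigenvalue of $A(G)$, with the same multiplicity as $\lambda$. A nonsingular graph $G$ has property (-SR) if for each eigenvalue $\lambda$ of $A(G)$, $-1/\lambda$ is also an eigenvalue of $A(G)$, with the same multiplicity as $\lambda$. The $m$-shadow graph $D_m(G)$ consists of $m$ copies $G_1,\dots,G_m$ of $G$, where each vertex $u$ in $G_i$ is joined to the neighbors of the corresponding vertex in $G_j$, $1\le i,j\le m$; its adjacency matrix is $J_m\otimes A(G)$ with $J_m$ the $m\times m$ all-ones matrix. $F_1^m(G)$ ($m>3$) is obtained from $D_m(G)$ by deleting all edges connecting vertices of $G_i$ with vertices of $G_{m-(i-1)}$ for $2\le i\le m-1$ (if $i=m-(i-1)$ these are the edges inside $G_i$) and removing the edges of $G_1$. Thus its adjacency matrix is $B\otimes A(G)$, where $B$ is the $m\times m$ 0-1 matrix with zeros exactly at positions $(1,1)$ and $(i,m+1-i)$, $2\le i\le m-1$. *)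

(* Defs.v *)
From HB Require Import structures.
From mathcomp Require Import all_boot all_order all_algebra.
Set Implicit Arguments.
Unset Strict Implicit.
Unset Printing Implicit Defensive.

Import GRing.Theory.

Record sgraph := SGraph {
  vertex :> finType;
  adj : rel vertex;
  adj_sym : symmetric adj;
  adj_irrefl : irreflexive adj
}.

(* The graph without vertices is not considered connected. *)
Definition connected (G : sgraph) : Prop :=
  0 < #|G| /\ forall u v : G, connect (@adj G) u v.

Section DeleteEdges.
Variables (G : sgraph) (d : rel G).
Hypothesis d_sym : symmetric d.

Definition delete_edges_rel : rel G := fun u v => adj u v && ~~ d u v.

Fact delete_edges_sym : symmetric delete_edges_rel.
Proof. by move=> u v; rewrite /delete_edges_rel adj_sym d_sym. Qed.

Fact delete_edges_irrefl : irreflexive delete_edges_rel.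
Proof. by move=> u; rewrite /delete_edges_rel adj_irrefl. Qed.

Definition delete_edges : sgraph :=
  SGraph delete_edges_sym delete_edges_irrefl.
End DeleteEdges.

Section Shadow.
Variables (m : nat) (G : sgraph).

(* The vertex (i, u) is the copy of u in the copy of G numbered i; copies are
   numbered from 0, so that G_1, ..., G_m are the copies 0, ..., m - 1. *)
Definition shadow_rel : rel ('I_m * G)%type := fun x y => adj x.2 y.2.

Fact shadow_sym : symmetric shadow_rel.
Proof. by move=> x y; rewrite /shadow_rel adj_sym. Qed.

Fact shadow_irrefl : irreflexive shadow_rel.
Proof. by move=> x; rewrite /shadow_rel adj_irrefl. Qed.

Definition shadow : sgraph := SGraph shadow_sym shadow_irrefl.

(* Numbered from 0, the copies G_i and G_(m - (i - 1)) with 2 <= i <= m - 1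
   are i and rev_ord i = m - 1 - i with 1 <= i <= m - 2. *)
Definition F1_deleted : rel shadow := fun x y =>
  ((x.1 == 0 :> nat) && (y.1 == 0 :> nat))
  || [&& 1 <= x.1, x.1 <= m - 2 & y.1 == rev_ord x.1].

Fact F1_deleted_sym : symmetric F1_deleted.
Proof.
move=> [i u] [j v]; rewrite /F1_deleted /= [(j == 0 :> nat) && _]andbC.
congr (_ || _).
suff imp (a b : 'I_m) : [&& 0 < a, a <= m - 2 & b == rev_ord a] ->
    [&& 0 < b, b <= m - 2 & a == rev_ord b].
  by apply/idP/idP; exact: imp.
case/and3P=> a_gt0 a_le /eqP->; rewrite rev_ordK eqxx andbT /=.
have m2 : 2 < m by rewrite -subn_gt0 (leq_trans a_gt0).
apply/andP; split; last by rewrite leq_sub2l.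
by rewrite subn_gt0; rewrite leq_subRL ?(ltnW m2) // in a_le.
Qed.

Definition F1 : sgraph := delete_edges F1_deleted_sym.
End Shadow.

Local Open Scope ring_scope.

(* The eigenvalues are taken in a field C of complex numbers, and their
   multiplicity is that of the root of the characteristic polynomial; the
   adjacency matrix being real symmetric, it is also the dimension of the
   eigenspace. *)
Section Spectrum.
Variables (C : numClosedFieldType) (G : sgraph).

Definition adj_mx : 'M[C]_#|G| :=
  \matrix_(i, j) (adj (enum_val i) (enum_val j))%:R.

Definition mult (a : C) : nat := mup a (char_poly adj_mx).

Definition nonsingular : Prop := adj_mx \in unitmx.

Definition property_SR : Prop :=
  nonsingular /\
  forall a : C, eigenvalue adj_mx a ->
    eigenvalue adj_mx a^-1 /\ mult a^-1 = mult a.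

Definition property_mSR : Prop :=
  nonsingular /\
  forall a : C, eigenvalue adj_mx a ->
    eigenvalue adj_mx (- a^-1) /\ mult (- a^-1) = mult a.
End Spectrum.

(* Main.v *)
Require Import Defs.
From HB Require Import structures.
From mathcomp Require Import all_boot all_order all_algebra.
From mathcomp Require Import fingroup perm mxtens zify ring.

Set Implicit Arguments.
Unset Strict Implicit.
Unset Printing Implicit Defensive.

(** The adjacency matrix of F_1^m(G) is the Kronecker product B (x) A of the 0-1
    pattern B of size m with the adjacency matrix A of G, so its eigenvalues,
    with multiplicity, are the products of an eigenvalue of B and one of A
    ([char_poly_tens]).

    The spectrum of B is explicit ([F1_pattern_spectrum]).  Let S be the
    permutation matrix that fixes both ends of {0, ..., m-1} and reverses the
    indices in between.  Then B = - S + U^T U, where the two rows of U are the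
    all-ones vector and the last unit vector, both fixed by S.  As S is an
    involution of trace 2 (m being even), - S has eigenvalues 1 and -1 with
    multiplicities p and p + 2, and the update U^T U only replaces two of the
    eigenvalues -1 by those of the 2 x 2 matrix - 1 + U U^T
    ([char_poly_add_rank]).  Hence B has eigenvalues 1 and -1, each p times,
    and the roots mu and - 1/mu of x^2 - (m - 1) x - 1, with mu > 1.

    If N x is the multiplicity of x for G, its multiplicity for F_1^m(G) is
    therefore F x = p N(x) + p N(-x) + N(x/mu) + N(-mu x).  When N is invariant
    under x -> - 1/x, the four terms of F(1/x) are those of F(x) in another
    order.  Conversely, suppose that F(1/x) = F(x) for all x and that N is
    not invariant; take x of largest modulus with N(-1/x) <> N(x).  The
    arguments mu x, - mu x and - mu^2 x have larger moduli, so in the equality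
    F(1/(mu x)) = F(mu x) all terms cancel except N(-1/x) and N(x), which is
    absurd ([count_F1_symmetry]). *)

Import Order.TTheory GRing.Theory Num.Theory.
Local Open Scope ring_scope.

(** * Characteristic polynomials *)

Section CharPoly.
Variable F : fieldType.

(** Similarity is phrased without an inverse so that it can be checked by
    computing two products. *)
Lemma char_poly_similar n (P A T : 'M[F]_n) :
  P \in unitmx -> P *m A = T *m P -> char_poly A = char_poly T.
Proof.
move=> uP PA.
pose P' := map_mx (@polyC F) P.
have dP : \det P' != 0.
  by rewrite det_map_mx polyC_eq0 -unitfE -unitmxE.
have /(congr1 determinant) : P' *m char_poly_mx A = char_poly_mx T *m P'.
  rewrite /char_poly_mx mulmxBr mulmxBl -!map_mxM PA.
  by rewrite -scalar_mxC.
by rewrite !det_mulmx mulrC => /(mulIf dP).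
Qed.

(** The sizes [n] and [n'] are equal but need not be convertible, as for
    [#|'I_m * G|] and [m * #|G|]. *)
Lemma char_poly_reindex n n' (A : 'M[F]_n) (A' : 'M[F]_n') (f : 'I_n -> 'I_n') :
  bijective f -> (forall i j, A i j = A' (f i) (f j)) ->
  char_poly A = char_poly A'.
Proof.
move=> bf; have := bij_eq_card bf; rewrite !card_ord => en.
case: n' / en A' f bf => A' f bf AE.
have fI := bij_inj bf.
pose g := (perm fI)^-1%g.
apply: (@char_poly_similar _ (perm_mx g) A A'); first exact: unitmx_perm.
rewrite -row_permE -{2}[g]invgK -col_permE.
apply/matrixP=> i j; rewrite !mxE AE.
by rewrite -!(permE fI) permKV invgK.
Qed.

Lemma mup_prod_XsubC (s : seq F) x :
  mup x (\prod_(a <- s) ('X - a%:P)) = count_mem x s.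
Proof.
elim: s => [|a s IHs].
  by rewrite big_nil mupNroot // root1.
rewrite big_cons mupM ?polyXsubC_eq0 ?(monic_neq0 (monic_prod_XsubC _ _ _)) //.
by rewrite IHs -['X - _]expr1 mup_XsubCX /=; case: eqP.
Qed.

Lemma prod_XsubC_perm (s t : seq F) :
  \prod_(a <- s) ('X - a%:P) = \prod_(a <- t) ('X - a%:P) -> perm_eq s t.
Proof.
by move=> st; apply/allP=> x _ /=; rewrite -!mup_prod_XsubC st.
Qed.

(** Conjugating by the block unitriangular matrix with lower left block [V]
    carries the block triangular matrix with diagonal [Q + U *m V], [c%:M] to
    the one with diagonal [Q], [c%:M + V *m U]: the lower left corner vanishes
    exactly because the rows of [V] are left eigenvectors of [Q] for [c].  Thus
    the update replaces [r] eigenvalues [c] of [Q] by those of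
    [c%:M + V *m U]. *)
Lemma char_poly_add_rank n r (Q : 'M[F]_n) (U : 'M[F]_(n, r)) (V : 'M[F]_(r, n)) c :
  V *m Q = c *: V ->
  char_poly (Q + U *m V) * ('X - c%:P) ^+ r =
  char_poly Q * char_poly (c%:M + V *m U).
Proof.
move=> VQ.
have char_poly_ublock (A : 'M[F]_n) D :
    char_poly (block_mx A U 0 D) = char_poly A * char_poly D.
  rewrite /char_poly /char_poly_mx map_block_mx map_mx0 (scalar_mx_block n r 'X).
  by rewrite opp_block_mx add_block_mx !subr0 sub0r det_ublock.
have -> : ('X - c%:P) ^+ r = char_poly (c%:M : 'M[F]_r).
  by rewrite char_poly_trig ?scalar_mx_is_trig //; under eq_bigr do rewrite mxE eqxx;
    rewrite prodr_const card_ord.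
rewrite -!char_poly_ublock.
apply: (@char_poly_similar _ (block_mx 1%:M 0 V 1%:M)).
  by rewrite unitmxE det_lblock !det1 mulr1 unitr1.
rewrite !mulmx_block !mul1mx !mul0mx !mulmx1 !mulmx0 !addr0 !add0r.
by rewrite mulmxDr VQ mulmxDl mul_scalar_mx mulmxA [_ + c%:M]addrC.
Qed.

End CharPoly.

(** * Eigenvalues over a closed field *)

Section Spectrum.
Variable C : numClosedFieldType.

Lemma trig_form n (A : 'M[C]_n) :
  exists P T : 'M[C]_n, [/\ P \in unitmx, is_trig_mx T & P *m A = T *m P].
Proof.
case: n A => [|n] A.
  exists 1%:M, 0; split; rewrite ?unitmx1 ?mx0_is_trig //.
  by apply/matrixP=> -[].
have [//|P /unitarymx_unit uP trP] := @Schur C _ A.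
exists P, (conjmx P A); split=> //.
by rewrite conjumx // mulmxKV.
Qed.

(** In the lexicographic order of pairs of indices, the Kronecker product of two
    lower triangular matrices is lower triangular, and its diagonal consists
    of the products of the diagonal entries.  Triangularizing both factors
    gives the general case. *)
Lemma char_poly_tens m n (B : 'M[C]_m) (A : 'M[C]_n) (t s : seq C) :
  char_poly B = \prod_(b <- t) ('X - b%:P) ->
  char_poly A = \prod_(a <- s) ('X - a%:P) ->
  char_poly (B *t A) = \prod_(c <- [seq b * a | b <- t, a <- s]) ('X - c%:P).
Proof.
have [P [T [uP trT PB]]] := trig_form B.
have [R [S [uR trS RA]]] := trig_form A.
rewrite (char_poly_similar uP PB) (char_poly_similar uR RA).
rewrite (char_poly_trig trT) (char_poly_trig trS).
rewrite -(big_map (fun i => T i i) xpredT (fun b => 'X - b%:P)).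
rewrite -(big_map (fun i => S i i) xpredT (fun b => 'X - b%:P)).
move=> /prod_XsubC_perm pt /prod_XsubC_perm ps.
rewrite big_allpairs_dep /= -(perm_big _ pt) big_map.
under eq_bigr do rewrite -(perm_big _ ps) big_map /=.
have uPR : P *t R \in unitmx.
  suff /mulmx1_unit[]: P *t R *m (invmx P *t invmx R) = 1%:M by [].
  rewrite tensmx_mul !mulmxV //; apply/matrixP => x y.
  rewrite -(mxtens_unindexK x) -(mxtens_unindexK y).
  case: (mxtens_unindex x) (mxtens_unindex y) => [i k] [j l].
  by rewrite tensmxE !mxE (can_eq (@mxtens_indexK m n)) -natrM mulnb.
rewrite (char_poly_similar uPR (T := T *t S)) ?tensmx_mul ?PB ?RA //.
rewrite char_poly_trig.
  rewrite pair_big /= (reindex (@mxtens_index m n)) /=.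
    by apply: eq_bigr => -[i j] _; rewrite tensmxE.
  by apply: onW_bij; exists (@mxtens_unindex m n);
    [exact: mxtens_indexK | exact: mxtens_unindexK].
apply/is_trig_mxP => x y.
rewrite -(mxtens_unindexK x) -(mxtens_unindexK y).
case: (mxtens_unindex x) (mxtens_unindex y) => [i k] [j l] lt_xy.
rewrite tensmxE.
have [lt_ij|] := ltnP i j; first by rewrite (is_trig_mxP trT) ?mul0r.
move: lt_xy => /= lt_xy le_ji.
rewrite [X in _ * X](is_trig_mxP trS) ?mulr0 //.
have lk := ltn_ord k; have ll := ltn_ord l.
nia.
Qed.

Lemma closed_spectrum n (A : 'M[C]_n) :
  exists s : seq C, char_poly A = \prod_(a <- s) ('X - a%:P).
Proof.
have [s ->] := closed_field_poly_normal (char_poly A); exists s.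
by rewrite (monicP (char_poly_monic A)) scale1r.
Qed.

(** The eigenvalues being 1 and -1, the size and the trace determine their
    multiplicities. *)
Lemma char_poly_involution n (Q : 'M[C]_n) :
  Q *m Q = 1%:M ->
  exists p q : nat, [/\ (p + q = n)%N, \tr Q = p%:R - q%:R &
    char_poly Q = ('X - 1%:P) ^+ p * ('X - (-1)%:P) ^+ q].
Proof.
move=> QQ; have [P [T [uP trT PQ]]] := trig_form Q.
have TE i : T i i = 1 \/ T i i = -1.
  have : eigenvalue Q (T i i).
    rewrite eigenvalue_root_char (char_poly_similar uP PQ) char_poly_trig //.
    by rewrite rootE horner_prod (bigD1 i) //= hornerXsubC subrr mul0r.
  case/eigenvalueP=> v vQ v0.
  have := congr1 (mulmx^~ Q) vQ; rewrite -mulmxA QQ mulmx1 -scalemxAl vQ scalerA.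
  move/eqP; rewrite -{1}[v]scale1r -subr_eq0 -scalerBl scaler_eq0 (negPf v0) orbF.
  by rewrite subr_eq0 eq_sym -expr2 sqrf_eq1 => /orP[]/eqP; [left|right].
have N11 : (1 == -1 :> C) = false.
  by rewrite eq_sym -subr_eq0 -opprD oppr_eq0 -(natrD _ 1 1) pnatr_eq0.
have TN i : (T i i != 1) = (T i i == -1).
  by case: (TE i) => ->; rewrite eqxx ?N11 // eq_sym N11.
exists #|[set i | T i i == 1]|, #|[set i | T i i != 1]|; split.
- rewrite -[RHS](card_ord n) -(cardC [set i | T i i == 1]); congr (_ + _)%N.
  by apply: eq_card => i; rewrite !inE.
- have -> : \tr Q = \tr T.
    have -> : T = P *m Q *m invmx P by rewrite PQ mulmxK.
    by rewrite mxtrace_mulC mulmxA mulVmx // mul1mx.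
  rewrite /mxtrace (bigID (fun i => T i i == 1)) /=.
  rewrite (eq_bigr (fun=> 1)) => [|i /eqP //].
  rewrite [X in _ + X](eq_bigr (fun=> -1)) => [|i]; last by rewrite TN => /eqP.
  by rewrite !sumr_const !cardsE mulNrn.
- rewrite (char_poly_similar uP PQ) char_poly_trig //.
  rewrite (bigID (fun i => T i i == 1)) /=.
  rewrite (eq_bigr (fun=> 'X - 1%:P)) => [|i /eqP -> //].
  rewrite [X in _ * X](eq_bigr (fun=> 'X - (-1)%:P)) => [|i]; last first.
    by rewrite TN => /eqP ->.
  by rewrite !prodr_const !cardsE.
Qed.

End Spectrum.
(** * The spectrum of the pattern of F_1^m *)

Section Pattern.
Variables (C : numClosedFieldType) (m : nat).

Definition F1_pattern : 'M[C]_m := \matrix_(i, j)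
  (~~ ((i == 0 :> nat) && (j == 0 :> nat)
       || [&& 1 <= i, i <= m - 2 & j == rev_ord i]))%N%:R.

Definition flip (i : 'I_m) : 'I_m :=
  if (i == 0 :> nat) || (i == m.-1 :> nat) then i else rev_ord i.

Lemma flipK : involutive flip.
Proof.
move=> i; rewrite {2}/flip; case: ifP => Hi; rewrite /flip ?Hi //.
case: ifP => [|_]; last exact: rev_ordK.
by move: Hi => /=; have := ltn_ord i; lia.
Qed.

Definition flip_mx : 'M[C]_m := \matrix_(i, j) (j == flip i)%:R.
(** Both rows are fixed by the flip, hence left eigenvectors of [- flip_mx] for
    -1. *)
Definition update_mx : 'M[C]_(2, m) :=
  \matrix_(a, i) (if a == 0 then 1 else (i == m.-1 :> nat)%:R).

Lemma mul_flip_mx p (V : 'M[C]_(p, m)) :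
  V *m flip_mx = \matrix_(a, j) V a (flip j).
Proof.
apply/matrixP=> a j; rewrite !mxE (bigD1 (flip j)) //= mxE flipK eqxx mulr1.
rewrite big1 ?addr0 // => i; rewrite mxE -(inv_eq flipK) eq_sym => /negPf->.
by rewrite mulr0.
Qed.

Lemma flip_mx_involution : flip_mx *m flip_mx = 1%:M.
Proof.
by rewrite mul_flip_mx; apply/matrixP=> i j; rewrite !mxE (can_eq flipK) eq_sym.
Qed.

Lemma update_mx_flip : update_mx *m flip_mx = update_mx.
Proof.
rewrite mul_flip_mx; apply/matrixP=> a j; rewrite !mxE; case: ifP => // _.
by congr (_%:R); rewrite /flip; case: ifP => //=; have := ltn_ord j; lia.
Qed.

(** Only the two ends are fixed points: a fixed point of the reversal would be
    the middle of {0, ..., m-1}, which does not exist for even [m]. *)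
Lemma trace_flip_mx : (1 < m)%N -> ~~ odd m -> \tr flip_mx = 2%:R.
Proof.
move=> m1 oddm; have m0 : (0 < m)%N by apply: ltnW.
rewrite /mxtrace; pose i0 := Ordinal m0.
have lm : (m.-1 < m)%N by rewrite prednK.
pose i1 := Ordinal lm.
rewrite (bigD1 i0) //= (bigD1 i1) /=; last by rewrite -val_eqE /=; lia.
rewrite !mxE /flip /= !eqxx orbT !eqxx big1 ?addr0 // => i.
rewrite -!val_eqE mxE /flip /= => /andP[/negPf -> /negPf ->] /=.
rewrite -val_eqE /=; case: eqP => // ei; exfalso.
by move: oddm; have := ltn_ord i; move: ei; lia.
Qed.

(** In [J - F1_pattern], with [J] the all-ones matrix, the flip appears except
    that its fixed point at the last index is missing; the second row of
    [update_mx] accounts for that entry. *)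
Lemma F1_patternE : (1 < m)%N ->
  F1_pattern = - flip_mx + update_mx^T *m update_mx.
Proof.
move=> m1; apply/matrixP=> i j; rewrite !mxE.
rewrite big_ord_recl big_ord1 !mxE /= /flip mulr1 -natrM mulnb.
have li := ltn_ord i; have lj := ltn_ord j.
have -> : [&& 1 <= i, i <= m - 2 & j == rev_ord i]%N
  = [&& i != 0 :> nat, i != m.-1 :> nat & j == rev_ord i].
  by lia.
have [i0|i0] := eqVneq (i : nat) 0%N.
  have -> : (j == i) = (j == 0 :> nat) by rewrite -val_eqE /= i0.
  rewrite /= i0 orbF.
  have -> : (0%N == m.-1) = false by lia.
  by case: eqP => _; rewrite /= ?addr0 ?oppr0 ?add0r ?addNr.
have [i1|i1] := eqVneq (i : nat) m.-1.
  have -> : (j == i) = (j == m.-1 :> nat) by rewrite -val_eqE /= i1.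
  rewrite /=.
  by case: eqP => _; rewrite /= ?addr0 ?oppr0 ?add0r ?addrA ?addNr ?add0r.
by rewrite /= addr0; case: eqP => _; rewrite /= ?oppr0 ?add0r ?addNr.
Qed.

(** The multiplicities of 1 and -1 come out equal: as the flip has trace 2, the
    eigenvalue -1 of [- flip_mx] occurs twice more often than 1, and the update
    of rank two replaces exactly two of its occurrences. *)
Lemma char_poly_F1_pattern : (1 < m)%N -> ~~ odd m ->
  exists p, char_poly F1_pattern =
    ('X - 1%:P) ^+ p * ('X - (-1)%:P) ^+ p * ('X^2 - (m.-1)%:R *: 'X - 1).
Proof.
move=> m1 oddm.
have QQ : - flip_mx *m - flip_mx = 1%:M.
  by rewrite mulmxN mulNmx opprK flip_mx_involution.
have [p [q [pq trQ chQ]]] := char_poly_involution QQ.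
have eq_pq : q = (p + 2)%N.
  rewrite linearN /= trace_flip_mx // in trQ.
  apply/eqP; rewrite -(eqr_nat C).
  by rewrite natrD -[2%:R]opprK trQ opprB addrC subrK.
exists p; have := @char_poly_add_rank _ _ _ (- flip_mx) update_mx^T update_mx (-1).
rewrite mulmxN update_mx_flip scaleN1r => /(_ erefl).
rewrite -F1_patternE // chQ eq_pq exprD => eqB.
have XN0 : ('X - (-1)%:P : {poly C}) ^+ 2 != 0.
  by rewrite expf_neq0 // polyXsubC_eq0.
move: (('X - (-1)%:P) ^+ 2) XN0 eqB => c2 c2N0 eqB.
apply: (mulIf c2N0); rewrite {}eqB -!mulrA; congr (_ * (_ * _)).
rewrite mulrC; congr (_ * _).
have UE : update_mx *m update_mx^T =
    \matrix_(a, b) (if (a == 0) && (b == 0) then m%:R else 1).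
  apply/matrixP=> a b; rewrite !mxE.
  have lm : (m.-1 < m)%N by lia.
  have sumE : \sum_(i < m) (i == m.-1 :> nat)%:R = 1 :> C.
    rewrite (bigD1 (Ordinal lm)) //= eqxx big1 ?addr0 // => i.
    by rewrite -val_eqE /= => /negPf ->.
  under eq_bigr do rewrite !mxE.
  case: (a == 0); case: (b == 0) => /=.
  - by under eq_bigr do rewrite mulr1; rewrite sumr_const card_ord.
  - by under eq_bigr do rewrite mul1r.
  - by under eq_bigr do rewrite mulr1.
  - by rewrite -[RHS]sumE; apply: eq_bigr => i _; rewrite -natrM mulnb andbb.
rewrite UE /char_poly (expand_det_row _ 0) big_ord_recl big_ord1 /cofactor.
rewrite !det_mx11 !mxE /=.
rewrite !(polyCD, polyCN, polyC1, polyCMn, polyC0, mulr1n, mulr0n).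
rewrite -mul_polyC !polyC_natr -[in m%:R](prednK (ltnW m1)) -natr1 addn0 /bump /=.
by ring.
Qed.
End Pattern.

(** * Multiplicities and their symmetries *)

Section Multiplicity.
Variable C : numClosedFieldType.

Lemma mup_char_poly_gt0 n (A : 'M[C]_n) a :
  (0 < mup a (char_poly A))%N = root (char_poly A) a.
Proof.
by rewrite -XsubC_dvd ?dvdp_XsubCl // monic_neq0 // char_poly_monic.
Qed.

Lemma unitmx_mup0 n (A : 'M[C]_n) : (A \in unitmx) = (mup 0 (char_poly A) == 0%N).
Proof.
rewrite unitmxE unitfE -[RHS]negbK -lt0n mup_char_poly_gt0.
by rewrite rootE horner_coef0 char_poly_det mulf_eq0 signr_eq0.
Qed.

(** Reduces both reciprocity properties to an identity between multiplicities,
    which holds for free where neither [a] nor [f a] is an eigenvalue; if only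
    [f a] is one, apply the property to it and use [f (f a) = a]. *)
Lemma mup_eigen_invariant n (A : 'M[C]_n) (f : C -> C) : involutive f ->
  (forall a, eigenvalue A a ->
     eigenvalue A (f a) /\ mup (f a) (char_poly A) = mup a (char_poly A)) <->
  (forall a, mup (f a) (char_poly A) = mup a (char_poly A)).
Proof.
move=> fK.
have eigE a : eigenvalue A a = (0 < mup a (char_poly A))%N.
  by rewrite mup_char_poly_gt0 eigenvalue_root_char.
split=> H a; last by rewrite !eigE H.
have [/H[]//|/negPf eA] := boolP (eigenvalue A a).
have [/H[]|/negPf efA] := boolP (eigenvalue A (f a)); first by rewrite fK.
by move: eA efA; rewrite !eigE; case: mup => //; case: mup.
Qed.

Lemma count_allpairs_mul (t s : seq C) x : 0 \notin t ->
  count_mem x [seq b * a | b <- t, a <- s] =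
  (\sum_(b <- t) count_mem (x / b)%R s)%N.
Proof.
elim: t => [|b t IHt]; first by rewrite big_nil.
rewrite inE negb_or eq_sym => /andP[b0 /IHt IH].
rewrite allpairs_cons count_cat big_cons IH count_map; congr (_ + _)%N.
apply: eq_count => a /=.
by rewrite -(inj_eq (mulfI b0) a (x / b)) mulrCA mulfV // mulr1.
Qed.

(** Right to left, the four terms of [F] are permuted.  Left to right is an
    extremal argument: the induction is on the number of entries of modulus
    greater than [`|x|] in the finite list [L] outside of which the claim is
    trivial, and the hypothesis is used at [mu * x], for which all terms but
    two concern points of larger modulus. *)
Lemma count_F1_symmetry (s : seq C) (p : nat) (mu : C) :
  1 < `|mu| ->
  let N x := count_mem x s in
  let F x := (p * N x + p * N (- x) + N (x / mu) + N (- (mu * x)))%N in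
  (forall x, F x^-1 = F x) <-> (forall x, N (- x^-1) = N x).
Proof.
move=> mu1 N F; split=> [symF|symN] x; last first.
  rewrite /F -(symN x) -(symN (- x)) -(symN (x / mu)) -(symN (- (mu * x))).
  rewrite !invrN !opprK !invfM invrK.
  rewrite [(p * _ + p * _)%N]addnC -!addnA; congr (_ + (_ + _))%N.
  by rewrite addnC [x^-1 * mu]mulrC [x^-1 / mu]mulrC.
have mu0 : mu != 0 by rewrite -normr_gt0 (lt_trans ltr01).
pose L := s ++ [seq - a^-1 | a <- s].
have NL y : y \notin L -> N (- y^-1) = N y.
  rewrite mem_cat negb_or => /andP[ys yms].
  rewrite /N (count_memPn ys); apply/count_memPn; apply: contra yms => yms.
  by apply/mapP; exists (- y^-1); rewrite // invrN invrK opprK.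
pose above (z : C) := count (fun y : C => `|z| < `|y|) L.
have [k] := ubnP (above x); elim: k x => // k IHk x ltk.
(* At 0 the claim holds by the convention that 0 is its own inverse. *)
have [x0|x0] := eqVneq x 0; first by rewrite x0 invr0 oppr0.
have above_x y : `|x| < `|y| -> N (- y^-1) = N y.
  move=> xy; have [yL|/NL //] := boolP (y \in L).
  apply: IHk; rewrite -ltnS; apply: leq_trans ltk; rewrite ltnS /above.
  rewrite !(seq.permP (perm_to_rem yL)) /= ltxx xy add0n add1n ltnS.
  by apply: sub_count => z /=; apply: lt_trans.
have Fx := symF (mu * x).
move: Fx; rewrite /F.
have x_lt_mux : `|x| < `|mu * x| by rewrite normrM ltr_pMl ?normr_gt0.
have x_lt_mumux : `|x| < `|mu * (mu * x)|.
  by rewrite (lt_trans x_lt_mux) // [X in _ < X]normrM ltr_pMl ?normr_gt0 ?mulf_neq0.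
rewrite -(above_x (mu * x)) // -(above_x (- (mu * x))) ?normrN //.
rewrite -(above_x (- (mu * (mu * x)))) ?normrN //.
rewrite !invrN !opprK [mu * x / mu]mulrC mulKf // -!invfM.
rewrite [(mu * x)^-1]invfM mulVKf // [(mu * x * mu)]mulrC.
(* Both sides are now the same sum, except for N (- x^-1) against N x. *)
move: (p * N (mu^-1 / x))%N (p * N (- (mu^-1 / x)))%N (N (mu * (mu * x))^-1).
by move=> a b c; rewrite [(a + b)%N]addnC -!addnA => /addnI/addnI; rewrite addnC => /addIn.
Qed.
End Multiplicity.

(** * The spectrum of F_1^m(G) *)

Section Main.
Variable C : numClosedFieldType.

Lemma F1_pattern_spectrum m : (3 < m)%N -> ~~ odd m ->
  exists (p : nat) (mu : C), 1 < `|mu| /\ char_poly (F1_pattern C m) =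
    \prod_(b <- nseq p 1 ++ nseq p (-1) ++ [:: mu; - mu^-1]) ('X - b%:P).
Proof.
move=> m3 oddm.
have [|p eqB] := @char_poly_F1_pattern C m _ oddm; first by lia.
pose n : C := (m.-1)%:R.
have n3 : 3%:R <= n by rewrite ler_nat; lia.
have n0 : 0 <= n by rewrite ler0n.
pose d := sqrtC (n ^+ 2 + 4%:R).
have d0 : 0 <= d by rewrite sqrtC_ge0 addr_ge0 ?exprn_ge0 ?ler0n.
have dd : d ^+ 2 = n ^+ 2 + 4%:R by rewrite sqrtCK.
pose mu := (n + d) / 2%:R.
have two0 : 2%:R != 0 :> C by rewrite pnatr_eq0.
have mu1 : 1 < mu.
  rewrite ltr_pdivlMr ?ltr0n // mul1r.
  have /lt_le_trans -> //: 2%:R < n by rewrite ltr_nat; lia.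
  by rewrite lerDl.
have mu0 : mu != 0 by rewrite gt_eqF // (lt_trans ltr01).
have muE : mu ^+ 2 = n * mu + 1.
  apply: (mulIf (mulf_neq0 two0 two0)).
  have mu2 : mu * 2%:R = n + d by rewrite divfK.
  have -> : mu ^+ 2 * (2%:R * 2%:R) = (mu * 2%:R) ^+ 2 by ring.
  have -> : (n * mu + 1) * (2%:R * 2%:R) = n * (mu * 2%:R) * 2%:R + 4%:R by ring.
  by rewrite mu2 sqrrD dd; ring.
exists p, mu; split; first by rewrite ger0_norm // (le_trans ler01) // ltW.
rewrite {}eqB !big_cat /= !big_nseq !iter_mulr_1 mulrA; congr (_ * _).
rewrite !big_cons big_nil mulr1 -/n.
have -> : n = mu - mu^-1.
  by apply: (mulIf mu0); rewrite mulrBl mulVf // -expr2 muE addrK.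
rewrite -mul_polyC polyCB polyCN.
have := mulfV mu0 => /(congr1 (@polyC C)); rewrite polyCM polyC1 => <-.
by ring.
Qed.

Lemma adj_mx_F1 (G : sgraph) m :
  char_poly (adj_mx C (F1 m G)) = char_poly (F1_pattern C m *t adj_mx C G).
Proof.
pose f (k : 'I_#|F1 m G|) : 'I_(m * #|G|) :=
  mxtens_index ((enum_val k).1, enum_rank (enum_val k).2).
apply: (@char_poly_reindex _ _ _ _ _ f).
  exists (fun l => let: (i, a) := mxtens_unindex l in
                   enum_rank ((i, enum_val a) : F1 m G)).
    by move=> k; rewrite /f mxtens_indexK enum_rankK -surjective_pairing enum_valK.
  move=> l; rewrite -[RHS](mxtens_unindexK l).
  by case: mxtens_unindex => i a; rewrite /f enum_rankK /= enum_valK.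
move=> k l; rewrite tensmxE !mxE !enum_rankK -natrM mulnb.
by rewrite andbC.
Qed.

Lemma mult_F1 (G : sgraph) m (s : seq C) : (3 < m)%N -> ~~ odd m ->
  char_poly (adj_mx C G) = \prod_(a <- s) ('X - a%:P) ->
  exists (p : nat) (mu : C), 1 < `|mu| /\
  forall x, mult (F1 m G) x =
    (p * count_mem x s + p * count_mem (- x)%R s
       + count_mem (x / mu)%R s + count_mem (- (mu * x))%R s)%N.
Proof.
move=> m3 oddm chA; have [p [mu [mu1 chB]]] := F1_pattern_spectrum m3 oddm.
have mu0 : mu != 0 by rewrite -normr_gt0 (lt_trans ltr01).
exists p, mu; split=> // x.
rewrite /mult adj_mx_F1 (char_poly_tens chB chA) mup_prod_XsubC.
rewrite count_allpairs_mul; last first.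
  rewrite !mem_cat !mem_nseq !inE ![0 == _]eq_sym oppr_eq0 oner_eq0.
  by rewrite oppr_eq0 invr_eq0 (negPf mu0) !andbF.
rewrite !big_cat !big_nseq !iter_addn_0 !big_cons big_nil /= addn0 !addnA.
rewrite divr1 !invrN invr1 mulrN1 invrK mulrN [x * mu]mulrC.
by rewrite ![(p * _)%N]mulnC.
Qed.

Lemma mult_spectrum (G : sgraph) : exists s : seq C,
  char_poly (adj_mx C G) = \prod_(a <- s) ('X - a%:P) /\
  forall x, mult G x = count_mem x s.
Proof.
have [s eA] := closed_spectrum (adj_mx C G); exists s; split=> // x.
by rewrite /mult eA mup_prod_XsubC.
Qed.

End Main.

Local Close Scope ring_scope.

Theorem theorem5p4 (C : numClosedFieldType) (G : sgraph) (m : nat) :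
  connected G -> 3 < m -> ~~ odd m ->
  (property_mSR C G <-> property_SR C (F1 m G)).
Proof.
move=> _ m3 oddm.
have [s [chA NE]] := mult_spectrum C G.
have [p [mu [mu1 FE]]] := mult_F1 m3 oddm chA.
have neg_invK : involutive (fun a : C => - a^-1)%R.
  by move=> a; rewrite invrN invrK opprK.
rewrite /property_mSR /property_SR /nonsingular !unitmx_mup0.
rewrite /mult (mup_eigen_invariant _ neg_invK) (mup_eigen_invariant _ (@invrK C)).
rewrite -!/(mult G _) -!/(mult (F1 m G) _).
have -> : (mult (F1 m G) (0 : C)%R == 0) = (mult G (0 : C)%R == 0).
  rewrite FE NE oppr0 mul0r mulr0 oppr0 !addn_eq0.
  by rewrite !muln_eq0; case: (count_mem _ s == 0); rewrite ?orbT ?andbF.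
have [symFN symNF] := count_F1_symmetry s p mu1.
split=> -[n0 sym]; split=> // x.
  rewrite -!/(mult (F1 m G) _) !FE; apply: symNF => y; rewrite -!NE; exact: sym.
rewrite -!/(mult G _) !NE; apply: symFN => y; rewrite -!FE; exact: sym.
Qed.
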